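(* Consider the attitude dynamics $$J\dot\Omega+\Omega\times J\Omega=u+\Delta,\qquad \dot R=R\hat\Omega,$$ with $R(t)\in\mathsf{SO(3)}$, $\Omega(t)\in\mathbb{R}^3$, control moment $u\in\mathbb{R}^3$, inertia matrix $J\in\mathbb{R}^{3\times3}$ whose minimum eigenvalue $\lambda_m$ and maximum eigenvalue $\lambda_M$ are known, and disturbance $\Delta\in\mathbb{R}^3$ satisfying $\|\Delta\|\le\delta$ for a known positive constant $\delta$. Let $R_d(t)\in\mathsf{SO(3)}$ be a given smooth attitude command with $\dot R_d=R_d\hat\Omega_d$. For positive constants $k_R,k_\Omega,k_J,\sigma,\epsilon\in\mathbb{R}$, define the control input and the update law for the estimate $\bar J\in\mathbb{R}^{3\times3}$ of $J$ by \begin{align*} u&=-k_Re_R-k_\Omega e_\Omega+\Omega\times\bar J\Omega+\bar J\alpha_d+v,\\ v&=-\frac{\delta^2e_A}{\delta\|e_A\|+\epsilon},\\ \dot{\bar J}&=\frac{k_J}{2}\left(-\alpha_de_A^T-e_A\alpha_d^T+\Omega\Omega^T\hat e_A-\hat e_A\Omega\Omega^T-2\sigma\bar J\right), \end{align*} where $e_A=e_\Omega+c\,e_R\in\mathbb{R}^3$ is an augmented error vector for a positive constant $c$ satisfying $$c<\min\left\{\sqrt{\frac{2b_1k_R\lambda_m}{\lambda_M^2}},\ \frac{\sqrt2\,k_\Omega}{\lambda_M\mathrm{tr}[G]},\ \frac{4k_Rk_\Omega}{k_\Omega^2+\frac{1}{\sqrt2}k_R\lambda_M\mathrm{tr}[G]}\right\}.$$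 Then, if $\sigma$ and $\epsilon$ are sufficiently small, the tracking errors $(e_R,e_\Omega)$ and the estimation error $\tilde J=J-\bar J$ are uniformly bounded.
   Context: $\mathsf{SO(3)}=\{R\in\mathbb{R}^{3\times3}\mid R^TR=I,\ \det R=1\}$. The hat map $\wedge:\mathbb{R}^3\to\mathfrak{so}(3)$ sends $x$ to the skew-symmetric matrix $\hat x$ with $\hat xy=x\times y$ for all $y\in\mathbb{R}^3$; the vee map $\vee$ is its inverse. $\|\cdot\|$ is the Euclidean norm on $\mathbb{R}^3$. $J$ is the inertia matrix of a rigid body in the body-fixed frame; $J$, its estimate $\bar J$, and $\tilde J=J-\bar J$ are all symmetric. $\Omega$ and $u$ are the angular velocity and control moment in the body-fixed frame. $G=\mathrm{diag}[g_1,g_2,g_3]$ with distinct positive constants $g_1,g_2,g_3$. The errors are $$e_R=\tfrac12\left(GR_d^TR-R^TR_dG\right)^\vee,\qquad e_\Omega=\Omega-R^TR_d\Omega_d,$$ and $\alpha_d=-\hat\Omega R^TR_d\Omega_d+R^TR_d\dot\Omega_d$, where $\Omega_d(t)\in\mathbb{R}^3$ is the desired angular velocity. The constant $b_1$ is $b_1=\frac{h_1}{h_2+h_3}$ with $h_1=\min\{g_1+g_2,g_2+g_3,g_3+g_1\}$, $h_2=\max\{(g_1-g_2)^2,(g_2-g_3)^2,(g_3-g_1)^2\}$, $h_3=\max\{(g_1+g_2)^2,(g_2+g_3)^2,(g_3+g_1)^2\}$. *)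

(* Defs.v *)
From HB Require Import structures.
From mathcomp Require Import all_boot all_order all_algebra.
From mathcomp Require Import all_classical all_reals all_analysis.
From mathcomp Require Import ring.
Set Implicit Arguments.
Unset Strict Implicit.
Unset Printing Implicit Defensive.
Import Order.TTheory GRing.Theory Num.Theory.
Import numFieldNormedType.Exports.
Local Open Scope classical_set_scope.
Local Open Scope ring_scope.

Section LinearAlgebra.
Variable K : realType.
Implicit Types (x y : 'cV[K]_3) (A : 'M[K]_3).

(* The norm that MathComp-Analysis puts on matrices is the sup norm.  [fnorm]
   is the Frobenius norm, which on column vectors is the Euclidean norm. *)
Definition fnorm m n (A : 'M[K]_(m, n)) : K :=
  Num.sqrt (\sum_(i < m) \sum_(j < n) A i j ^+ 2).

Definition SO3 A : Prop := A^T *m A = 1%:M /\ \det A = 1.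

(* Indices 'I_3 are added modulo 3. *)
Definition crossp x y : 'cV[K]_3 :=
  \col_(i < 3) (x (i + 1) 0 * y (i + 2%:R) 0 - x (i + 2%:R) 0 * y (i + 1) 0).

Definition hat x : 'M[K]_3 :=
  \matrix_(i < 3, j < 3) crossp x (delta_mx j 0) i 0.

(* Inverse of [hat] on skew-symmetric matrices; see [hatK] and [veeK]. *)
Definition vee A : 'cV[K]_3 := \col_(i < 3) A (i + 2%:R) (i + 1).

Lemma hat_mul x y : hat x *m y = crossp x y.
Proof.
have [f xE] : exists f, forall i : 'I_3, x i 0 = f (val i).
  by exists (fun k => x (inord k) 0) => i; rewrite inord_val.
have [g yE] : exists g, forall i : 'I_3, y i 0 = g (val i).
  by exists (fun k => y (inord k) 0) => i; rewrite inord_val.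
apply/matrixP => i j; rewrite (ord1 j) !mxE !big_ord_recl big_ord0 !mxE !xE !yE.
by case: i => [[|[|[|//]]] p] /=; ring.
Qed.

Lemma hatK : cancel hat vee.
Proof.
move=> x; apply/matrixP => i j; rewrite (ord1 j) !mxE.
by case: i => [[|[|[|//]]] p] /=; rewrite mulr0 mulr1 subr0;
  congr (fun_of_matrix _ _ _); apply/val_inj.
Qed.

Lemma veeK A : A^T = - A -> hat (vee A) = A.
Proof.
move=> /matrixP skewA.
have N k l : A k l = - A l k by have := skewA l k; rewrite !mxE.
have [f AE] : exists f, forall i j : 'I_3, A i j = f (val i) (val j).
  by exists (fun k l => A (inord k) (inord l)) => i j; rewrite !inord_val.
have A0 k : A k k = 0.
  by have /eqP := N k k; rewrite -subr_eq0 opprK -mulr2n mulrn_eq0 => /eqP.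
have fN (k l : 'I_3) : f (val k) (val l) = - f (val l) (val k) by rewrite -!AE.
have f0 (k : 'I_3) : f (val k) (val k) = 0 by rewrite -AE.
have N10 := fN 1 0; have N20 := fN 2%:R 0; have N21 := fN 2%:R 1.
have f00 := f0 0; have f11 := f0 1; have f22 := f0 2%:R.
apply/matrixP => i j; rewrite !mxE !AE.
move: N10 N20 N21 f00 f11 f22 => /= N10 N20 N21 f00 f11 f22.
by case: i => [[|[|[|//]]] p]; case: j => [[|[|[|//]]] q] /=;
  rewrite ?N10 ?N20 ?N21 ?f00 ?f11 ?f22; ring.
Qed.

End LinearAlgebra.

Section UniformBoundedness.
Variable K : realType.

(* [traj t0 t1 z] says that z is a trajectory of the (nonautonomous) error
   system on the time interval [t0, t1], where 0 <= t0.  The bound b depends on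
   the bound a on the initial error only, not on the initial time.  Since t1
   is arbitrary, trajectories defined for all times t >= t0 are covered, and
   so are those not assumed to exist for all times. *)
Definition uniformly_bounded (E : Type) (size : E -> K)
    (traj : K -> K -> (K -> E) -> Prop) : Prop :=
  forall a : K, 0 < a -> exists2 b : K, 0 < b &
    forall (t0 t1 : K) (z : K -> E), 0 <= t0 -> traj t0 t1 z ->
      size (z t0) <= a -> forall t, t0 <= t <= t1 -> size (z t) <= b.

End UniformBoundedness.

Section AttitudeTracking.
Variable K : realType.
Implicit Types (R Rd G J Jbar : 'M[K]_3) (Om Omd dOmd eA al : 'cV[K]_3).

Definition inertia_matrix J : Prop :=
  J^T = J /\ forall x : 'cV[K]_3, x != 0 -> 0 < (x^T *m J *m x) 0 0.

Definition min_eigenvalue J (l : K) : Prop :=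
  eigenvalue J l /\ forall a, eigenvalue J a -> l <= a.

Definition max_eigenvalue J (l : K) : Prop :=
  eigenvalue J l /\ forall a, eigenvalue J a -> a <= l.

Definition diagG (g1 g2 g3 : K) : 'M[K]_3 :=
  diag_mx (\row_(i < 3) [:: g1; g2; g3]`_i).

Definition b1 (g1 g2 g3 : K) : K :=
  let h1 := Num.min (g1 + g2) (Num.min (g2 + g3) (g3 + g1)) in
  let h2 := Num.max ((g1 - g2) ^+ 2)
              (Num.max ((g2 - g3) ^+ 2) ((g3 - g1) ^+ 2)) in
  let h3 := Num.max ((g1 + g2) ^+ 2)
              (Num.max ((g2 + g3) ^+ 2) ((g3 + g1) ^+ 2)) in
  h1 / (h2 + h3).

(* A smooth function on [0, +oo[ is the restriction of one on the whole line;
   the values of Rd and Omd at negative times are irrelevant. *)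
Definition attitude_command (Rd : K -> 'M[K]_3) (Omd : K -> 'cV[K]_3) : Prop :=
  [/\ forall (n : nat) (t : K), derivable (derive1n n Rd) t 1,
      forall t, 0 <= t -> SO3 (Rd t)
    & forall t, 0 <= t -> derive1 Rd t = Rd t *m hat (Omd t)].

Definition err_R G Rd R : 'cV[K]_3 :=
  2^-1 *: vee (G *m Rd^T *m R - R^T *m Rd *m G).

Definition err_Om Rd Omd R Om : 'cV[K]_3 := Om - R^T *m Rd *m Omd.

Definition err_A G (c : K) Rd Omd R Om : 'cV[K]_3 :=
  err_Om Rd Omd R Om + c *: err_R G Rd R.

(* dOmd stands for the time derivative of Omd. *)
Definition alpha_d Rd Omd dOmd R Om : 'cV[K]_3 :=
  - (hat Om *m R^T *m Rd *m Omd) + R^T *m Rd *m dOmd.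

Definition robust_term (delta eps : K) eA : 'cV[K]_3 :=
  - ((delta ^+ 2 / (delta * fnorm eA + eps)) *: eA).

Definition control G (kR kOm c delta eps : K) Rd Omd dOmd R Om Jbar
    : 'cV[K]_3 :=
  - (kR *: err_R G Rd R) - kOm *: err_Om Rd Omd R Om
  + crossp Om (Jbar *m Om) + Jbar *m alpha_d Rd Omd dOmd R Om
  + robust_term delta eps (err_A G c Rd Omd R Om).

Definition update_law (kJ sigma : K) eA al Om Jbar : 'M[K]_3 :=
  (kJ / 2) *: (- (al *m eA^T) - eA *m al^T
               + Om *m Om^T *m hat eA - hat eA *m Om *m Om^T
               - (2 * sigma) *: Jbar).

(* Closed-loop solution on [t0, t1] under the disturbance Delta, which is any
   function of time bounded by delta (hence possibly state-dependent). *)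
Record closed_loop G J (delta kR kOm kJ c sigma eps : K)
    (Rd : K -> 'M[K]_3) (Omd : K -> 'cV[K]_3) (t0 t1 : K)
    (R : K -> 'M[K]_3) (Om : K -> 'cV[K]_3) (Jbar : K -> 'M[K]_3)
    (Delta : K -> 'cV[K]_3) : Prop := ClosedLoop {
  cl_SO3 : forall t, t0 <= t <= t1 -> SO3 (R t) ;
  cl_sym : forall t, t0 <= t <= t1 -> (Jbar t)^T = Jbar t ;
  cl_Delta : forall t, t0 <= t <= t1 -> fnorm (Delta t) <= delta ;
  cl_cont_R : {within `[t0, t1], continuous R} ;
  cl_cont_Om : {within `[t0, t1], continuous Om} ;
  cl_cont_Jbar : {within `[t0, t1], continuous Jbar} ;
  cl_derivable : forall t, t0 < t < t1 ->
    [/\ derivable R t 1, derivable Om t 1 & derivable Jbar t 1] ;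
  cl_kinematics : forall t, t0 < t < t1 -> derive1 R t = R t *m hat (Om t) ;
  cl_dynamics : forall t, t0 < t < t1 ->
    J *m derive1 Om t + crossp (Om t) (J *m Om t) =
    control G kR kOm c delta eps (Rd t) (Omd t) (derive1 Omd t) (R t) (Om t)
      (Jbar t) + Delta t ;
  cl_update : forall t, t0 < t < t1 ->
    derive1 Jbar t =
    update_law kJ sigma (err_A G c (Rd t) (Omd t) (R t) (Om t))
      (alpha_d (Rd t) (Omd t) (derive1 Omd t) (R t) (Om t)) (Om t) (Jbar t) }.

(* (e_R, e_Omega, J - Jbar) *)
Definition errors : Type := ('cV[K]_3 * 'cV[K]_3 * 'M[K]_3)%type.

Definition errors_norm (z : errors) : K :=
  Num.sqrt (fnorm z.1.1 ^+ 2 + fnorm z.1.2 ^+ 2 + fnorm z.2 ^+ 2).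

Definition error_trajectory G J (delta kR kOm kJ c sigma eps : K)
    (Rd : K -> 'M[K]_3) (Omd : K -> 'cV[K]_3) (t0 t1 : K) (z : K -> errors)
    : Prop :=
  exists (R : K -> 'M[K]_3) (Om : K -> 'cV[K]_3) (Jbar : K -> 'M[K]_3)
         (Delta : K -> 'cV[K]_3),
    closed_loop G J delta kR kOm kJ c sigma eps Rd Omd t0 t1 R Om Jbar Delta /\
    forall t, z t = (err_R G (Rd t) (R t),
                     err_Om (Rd t) (Omd t) (R t) (Om t), J - Jbar t).

End AttitudeTracking.

(* Main.v *)
Require Import Defs.
From HB Require Import structures.
From mathcomp Require Import all_boot all_order all_algebra.
From mathcomp Require Import all_classical all_reals all_analysis.
From mathcomp Require Import ring lra.
Set Implicit Arguments.
Unset Strict Implicit.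
Unset Printing Implicit Defensive.
Import Order.TTheory GRing.Theory Num.Theory.
Import numFieldNormedType.Exports.
Local Open Scope classical_set_scope.
Local Open Scope ring_scope.

(** The proof is a Lyapunov argument in the augmented error
    [e = e_Omega + c e_R] and the inertia error [P = Jbar - J], with
      [V = 1/2 e . J e + 1/(2 k_J) |P|^2],
    which is positive definite because [J] is.

    Differentiating [V] along the closed loop uses two kinematic facts.  First,
    [e_R' = E e_Omega], where the matrix [E] ([rate_mx]) has Frobenius norm at
    most [tr G / sqrt 2] ([is_derive_err_R], [fnorm_rate_mx]).  Secondly,
    [e_Omega' = Omega' - alpha_d] ([is_derive_err_Om]).  The terms of [e . J e']
    that contain the unknown [P] are [e . (Omega x P Omega + P alpha_d)]; the
    update law is designed so that [1/k_J <P, Jbar'>] cancels them exactly and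
    leaves only the leakage [- sigma <P, Jbar>] ([adaptation_cancels]).  In
    particular [alpha_d] disappears, so that the estimate is uniform in the
    desired velocity.  The robust term beats the disturbance up to [eps]
    ([robust_term_le]).

    What remains is, with [e_Omega = e - c e_R],
      [V' <= - gam |e|^2 + N |e| + eps - sigma <P, Jbar>],
    where [gam = k_Omega - c lambda_M tr G / sqrt 2] is positive by the second
    bound on [c].  The attitude error enters only through [N], and it is bounded
    a priori, [|e_R| <= |G|], since rotations form a bounded set
    ([fnorm_err_R]).  Completing squares gives
      [V' <= - (gam/2 |e|^2 + sigma/2 |P|^2) + C <= - kap V + C]
    ([lyapunov_decay]), so [V] never exceeds [max (V(t0), C / kap)]
    ([decay_bound]), uniformly in [t0].  The eigenvalues of [J] bound [e . J e]
    above and below by [|e|^2] ([rayleigh_max], [rayleigh_min]), so a bound on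
    [V] is a bound on [e] and [P], hence on [e_Omega] and [J - Jbar]. *)

(** * Frobenius product, Cauchy-Schwarz and Rayleigh quotients *)

(** Semidefiniteness suffices, and it is all that is known of the form of
    [mu - A] when the inequality is used for [rayleigh_max]. *)
Lemma cauchy_schwarz_form (K : realFieldType) (V : lmodType K) (f : V -> V -> K) :
  (forall x y, f x y = f y x) ->
  (forall a x y z, f x (a *: y + z) = a * f x y + f x z) ->
  (forall x, 0 <= f x x) ->
  forall x y, f x y ^+ 2 <= f x x * f y y.
Proof.
move=> fC flin f_ge0 x y.
have expand a b : f (a *: x + b *: y) (a *: x + b *: y) =
    a ^+ 2 * f x x + 2 * a * b * f x y + b ^+ 2 * f y y.
  have f0 z : f z 0 = 0 by have := flin 1 z 0 0; rewrite scaler0 addr0 mul1r; lra.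
  have fZ c z w : f z (c *: w) = c * f z w.
    by rewrite -[c *: w]addr0 flin f0 addr0.
  rewrite flin fZ (fC _ x) (fC _ y) !flin !fZ (fC y x); ring.
have := f_ge0 y; rewrite le_eqVlt => /predU1P[fyy|fyy_gt0].
  have [->|fxy] := eqVneq (f x y) 0; first by rewrite -fyy expr0n mulr0.
  (* along x + s y the form is affine in s, so it cannot stay nonnegative *)
  have := f_ge0 (1 *: x + (- (f x x + 1) / (2 * f x y)) *: y).
  rewrite expand -fyy mulr0 addr0.
  have -> : 1 ^+ 2 * f x x + 2 * 1 * (- (f x x + 1) / (2 * f x y)) * f x y = -1.
    by field.
  by rewrite lerNr oppr0 ler10.
have := f_ge0 (f y y *: x + (- f x y) *: y); rewrite expand.
have -> : f y y ^+ 2 * f x x + 2 * f y y * - f x y * f x y +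
    (- f x y) ^+ 2 * f y y = f y y * (f x x * f y y - f x y ^+ 2) by ring.
by rewrite pmulr_rge0// subr_ge0.
Qed.

Section FrobeniusProduct.
Variable K : realType.

(** The Frobenius product, which on columns is the Euclidean one. *)
Definition dot m n (A B : 'M[K]_(m, n)) : K := \tr (A^T *m B).

Lemma dotE m n (A B : 'M[K]_(m, n)) :
  dot A B = \sum_i \sum_j A i j * B i j.
Proof.
rewrite /dot /mxtrace exchange_big; apply: eq_bigr => i _.
by rewrite mxE; apply: eq_bigr => j _; rewrite mxE.
Qed.

Lemma dotC m n (A B : 'M[K]_(m, n)) : dot A B = dot B A.
Proof. by rewrite /dot -mxtrace_tr trmx_mul trmxK. Qed.

Lemma dotDr m n (A B C : 'M[K]_(m, n)) : dot A (B + C) = dot A B + dot A C.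
Proof. by rewrite /dot mulmxDr linearD. Qed.

Lemma dotZr m n a (A B : 'M[K]_(m, n)) : dot A (a *: B) = a * dot A B.
Proof. by rewrite /dot -scalemxAr linearZ. Qed.

Lemma dotNr m n (A B : 'M[K]_(m, n)) : dot A (- B) = - dot A B.
Proof. by rewrite -scaleN1r dotZr mulN1r. Qed.

Lemma dotDl m n (A B C : 'M[K]_(m, n)) : dot (A + B) C = dot A C + dot B C.
Proof. by rewrite !(dotC _ C) dotDr. Qed.

Lemma dotZl m n a (A B : 'M[K]_(m, n)) : dot (a *: A) B = a * dot A B.
Proof. by rewrite !(dotC _ B) dotZr. Qed.

Lemma dotNl m n (A B : 'M[K]_(m, n)) : dot (- A) B = - dot A B.
Proof. by rewrite !(dotC _ B) dotNr. Qed.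

Lemma dot_mull m n p (A : 'M[K]_(m, n)) (M : 'M[K]_(m, p)) B :
  dot A (M *m B) = dot (M^T *m A) B.
Proof. by rewrite /dot trmx_mul trmxK mulmxA. Qed.

Lemma dot_mulr m n p (A : 'M[K]_(m, n)) B (M : 'M[K]_(p, n)) :
  dot A (B *m M) = dot (A *m M^T) B.
Proof. by rewrite /dot trmx_mul trmxK mulmxA mxtrace_mulC mulmxA. Qed.

Lemma fnorm_ge0 m n (A : 'M[K]_(m, n)) : 0 <= fnorm A.
Proof. exact: sqrtr_ge0. Qed.

Lemma sqr_fnorm m n (A : 'M[K]_(m, n)) : fnorm A ^+ 2 = dot A A.
Proof.
rewrite /fnorm dotE sqr_sqrtr; last by do 2!apply: sumr_ge0 => ? _; exact: sqr_ge0.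
by apply: eq_bigr => i _; apply: eq_bigr => j _; rewrite expr2.
Qed.

Lemma dot_ge0 m n (A : 'M[K]_(m, n)) : 0 <= dot A A.
Proof. by rewrite -sqr_fnorm sqr_ge0. Qed.

Lemma fnorm_gt0 m n (A : 'M[K]_(m, n)) : A != 0 -> 0 < fnorm A.
Proof.
move=> A0; rewrite lt_neqAle fnorm_ge0 andbT eq_sym.
apply: contra A0 => /eqP nA0; apply/eqP/matrixP => i j; rewrite mxE.
have := sqr_fnorm A; rewrite nA0 expr0n/= dotE => /esym/eqP.
have sq k l : 0 <= A k l * A k l by rewrite -expr2 sqr_ge0.
rewrite psumr_eq0; last by move=> k _; exact: sumr_ge0.
move=> /allP/(_ i (mem_index_enum i))/=; rewrite psumr_eq0//.
by move=> /allP/(_ j (mem_index_enum j))/=; rewrite mulf_eq0 orbb => /eqP.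
Qed.

Lemma ler_fnorm m n (A : 'M[K]_(m, n)) r :
  0 <= r -> dot A A <= r ^+ 2 -> fnorm A <= r.
Proof.
by move=> r0; rewrite -sqr_fnorm ler_pXn2r// nnegrE fnorm_ge0.
Qed.

Lemma cauchy_schwarz m n (A B : 'M[K]_(m, n)) :
  `|dot A B| <= fnorm A * fnorm B.
Proof.
rewrite -(@ler_pXn2r _ 2)// ?nnegrE ?mulr_ge0 ?fnorm_ge0//.
rewrite -normrX ger0_norm ?sqr_ge0// exprMn !sqr_fnorm.
apply: (@cauchy_schwarz_form _ _ (@dot m n)) => [|a X Y Z|]; first exact: dotC.
- by rewrite dotDr dotZr.
- exact: dot_ge0.
Qed.

Lemma dot_le m n (A B : 'M[K]_(m, n)) : dot A B <= fnorm A * fnorm B.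
Proof. exact: le_trans (ler_norm _) (cauchy_schwarz _ _). Qed.

Lemma fnormZ m n a (A : 'M[K]_(m, n)) : fnorm (a *: A) = `|a| * fnorm A.
Proof.
apply/eqP; rewrite -(@eqrXn2 _ 2)// ?mulr_ge0 ?fnorm_ge0//.
by rewrite exprMn !sqr_fnorm dotZl dotZr -normrX ger0_norm ?sqr_ge0// mulrA.
Qed.

Lemma fnormN m n (A : 'M[K]_(m, n)) : fnorm (- A) = fnorm A.
Proof. by rewrite -scaleN1r fnormZ normrN1 mul1r. Qed.

Lemma fnormT m n (A : 'M[K]_(m, n)) : fnorm A^T = fnorm A.
Proof.
rewrite /fnorm exchange_big; congr Num.sqrt.
by apply: eq_bigr => i _; apply: eq_bigr => j _; rewrite mxE.
Qed.

Lemma fnormD m n (A B : 'M[K]_(m, n)) : fnorm (A + B) <= fnorm A + fnorm B.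
Proof.
apply: ler_fnorm; first by rewrite addr_ge0 ?fnorm_ge0.
rewrite dotDl !dotDr (dotC B A) sqrrD !sqr_fnorm.
by have := dot_le A B; lra.
Qed.

Lemma fnormM m n p (A : 'M[K]_(m, n)) (B : 'M[K]_(n, p)) :
  fnorm (A *m B) <= fnorm A * fnorm B.
Proof.
apply: ler_fnorm; first by rewrite mulr_ge0 ?fnorm_ge0.
rewrite exprMn !sqr_fnorm !dotE mulr_suml; apply: ler_sum => i _.
rewrite exchange_big mulr_sumr; apply: ler_sum => j _.
have -> : (A *m B) i j = dot (row i A)^T (col j B).
  rewrite dotE mxE; apply: eq_bigr => k _.
  by rewrite big_ord1 !mxE.
rewrite -expr2 -[leLHS]ger0_norm ?sqr_ge0// normrX.
apply: (le_trans (_ : _ <= (fnorm (row i A)^T * fnorm (col j B)) ^+ 2)).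
  by rewrite ler_pXn2r ?nnegrE ?mulr_ge0 ?fnorm_ge0// cauchy_schwarz.
rewrite exprMn !sqr_fnorm !dotE.
apply: ler_pM; do ?by do 2!apply: sumr_ge0 => ? _; rewrite -expr2 sqr_ge0.
  by apply: ler_sum => k _; rewrite big_ord1 !mxE.
by apply: ler_sum => k _; rewrite big_ord1 !mxE.
Qed.

End FrobeniusProduct.

Section Rayleigh.
Variable K : realType.

Definition psd n (A : 'M[K]_n) : Prop :=
  A^T = A /\ forall x : 'cV[K]_n, 0 <= dot x (A *m x).

Lemma psd_cauchy_schwarz n (A : 'M[K]_n) (x y : 'cV[K]_n) : psd A ->
  dot x (A *m y) ^+ 2 <= dot x (A *m x) * dot y (A *m y).
Proof.
move=> [symA A_ge0].
apply: (cauchy_schwarz_form (f := fun u v : 'cV[K]_n => dot u (A *m v))) => //.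
- by move=> u v; rewrite dotC dot_mull symA.
- by move=> a u v w; rewrite mulmxDr -scalemxAr dotDr dotZr.
Qed.

(** Cauchy-Schwarz for the form of [A] at [x] and [A^-1 x] reads
    [|x|^4 <= (x . A x) (x . A^-1 x)], and the last factor is at most
    [|A^-1| |x|^2]; hence an invertible semidefinite matrix is coercive. *)
Lemma unit_psd_ge n (A : 'M[K]_n) : psd A -> A \in unitmx ->
  exists2 e, 0 < e & forall x : 'cV[K]_n, e * dot x x <= dot x (A *m x).
Proof.
move=> psdA uA.
have N_gt0 : 0 < fnorm (invmx A) + 1 by rewrite ltr_wpDl ?fnorm_ge0.
exists (fnorm (invmx A) + 1)^-1; first by rewrite invr_gt0.
move=> x; have [->|x0] := eqVneq x 0; first by rewrite mulmx0 /dot mulmx0 linear0 mulr0.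
rewrite ler_pdivrMl//.
have xx_gt0 : 0 < dot x x by rewrite -sqr_fnorm exprn_gt0 ?fnorm_gt0.
have := psd_cauchy_schwarz x (invmx A *m x) psdA.
rewrite mulmxA mulmxV// mul1mx (dotC (_ *m x)) expr2 => h.
rewrite -(ler_pM2r xx_gt0); apply: (le_trans h).
rewrite mulrAC mulrC ler_wpM2r//; first exact: psdA.2.
apply: (le_trans (dot_le _ _)).
apply: (le_trans (ler_wpM2l (fnorm_ge0 _) (fnormM _ _))).
by rewrite mulrCA -expr2 sqr_fnorm ler_wpM2r ?dot_ge0// lerDl.
Qed.

(** Let [mu] be the least [s] for which [s - A] is semidefinite.  Were
    [mu - A] invertible, it would be coercive by [unit_psd_ge], and some
    [s < mu] would do as well.  So [mu] is an eigenvalue, and it bounds the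
    Rayleigh quotient. *)
Lemma rayleigh_max n (A : 'M[K]_n.+1) : A^T = A ->
  exists2 mu, eigenvalue A mu &
    forall x : 'cV[K]_n.+1, dot x (A *m x) <= mu * dot x x.
Proof.
move=> symA.
pose S := [set s | forall x : 'cV[K]_n.+1, dot x (A *m x) <= s * dot x x].
have S0 : S !=set0.
  exists (fnorm A) => x; rewrite -sqr_fnorm expr2 mulrCA.
  exact: (le_trans (dot_le _ _) (ler_wpM2l (fnorm_ge0 _) (fnormM _ _))).
pose e0 : 'cV[K]_n.+1 := delta_mx 0 0.
have e0_gt0 : 0 < dot e0 e0.
  rewrite -sqr_fnorm exprn_gt0// fnorm_gt0//; apply/eqP => /matrixP/(_ 0 0).
  by rewrite !mxE eqxx => /eqP; rewrite oner_eq0.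
have lbS : has_lbound S.
  exists (dot e0 (A *m e0) / dot e0 e0) => s /(_ e0).
  by rewrite ler_pdivrMr.
have infS : S (inf S).
  move=> x; have [->|x0] := eqVneq x 0; first by rewrite mulmx0 /dot mulmx0 linear0 mulr0.
  have xx_gt0 : 0 < dot x x by rewrite -sqr_fnorm exprn_gt0 ?fnorm_gt0.
  rewrite -ler_pdivrMr//; apply: lb_le_inf => // s /(_ x).
  by rewrite ler_pdivrMr.
exists (inf S) => //.
set mu := inf S; pose B := mu%:M - A.
have dotB x : dot x (B *m x) = mu * dot x x - dot x (A *m x).
  by rewrite mulmxBl mul_scalar_mx dotDr dotNr dotZr.
have psdB : psd B.
  split=> [|x]; first by rewrite linearB/= symA tr_scalar_mx.
  by rewrite dotB subr_ge0; exact: infS.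
have nuB : B \notin unitmx.
  apply/negP => /(unit_psd_ge psdB)[e e_gt0 eB].
  have : S (mu - e).
    by move=> x; have := eB x; rewrite dotB mulrBl; lra.
  by move=> /(ge_inf lbS); rewrite -/mu; lra.
rewrite /eigenvalue /eigenspace kermx_eq0 row_free_unit.
apply: contra nuB => uA.
by rewrite /B -(opprB A) unitmxE -scaleN1r detZ unitrM unitrX ?unitrN1.
Qed.

Lemma rayleigh_min n (A : 'M[K]_n.+1) : A^T = A ->
  exists2 mu, eigenvalue A mu &
    forall x : 'cV[K]_n.+1, mu * dot x x <= dot x (A *m x).
Proof.
move=> symA; have [|mu /eigenvalueP[v vA v0] muP] := @rayleigh_max n (- A).
  by rewrite linearN/= symA.
exists (- mu).
  by apply/eigenvalueP; exists v => //; rewrite scaleNr -vA mulmxN opprK.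
by move=> x; have := muP x; rewrite mulNmx dotNr mulNr; lra.
Qed.

End Rayleigh.

(** * Cross products and rotations *)

Section RotationAlgebra.
Variable K : realType.
Implicit Types (x y a : 'cV[K]_3) (A B M Q : 'M[K]_3).

(** Naming the entries by functions on [nat] lets the sums and indices modulo 3
    compute, so that a polynomial identity between entries becomes a goal for
    [ring]. *)
Lemma cV3_entries x : exists f : nat -> K, forall i : 'I_3, x i 0 = f (val i).
Proof. by exists (fun k => x (inord k) 0) => i; rewrite inord_val. Qed.

Lemma M3_entries A :
  exists f : nat -> nat -> K, forall i j : 'I_3, A i j = f (val i) (val j).
Proof. by exists (fun k l => A (inord k) (inord l)) => i j; rewrite !inord_val. Qed.

Lemma det_mx33 A (f : nat -> nat -> K) :
  (forall i j : 'I_3, A i j = f (val i) (val j)) ->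
  \det A = f 0%N 0%N * (f 1%N 1%N * f 2%N 2%N - f 1%N 2%N * f 2%N 1%N)
         - f 0%N 1%N * (f 1%N 0%N * f 2%N 2%N - f 1%N 2%N * f 2%N 0%N)
         + f 0%N 2%N * (f 1%N 0%N * f 2%N 1%N - f 1%N 1%N * f 2%N 0%N).
Proof.
move=> AE; rewrite (expand_det_row A ord0) !big_ord_recl big_ord0 /cofactor.
rewrite !(expand_det_row _ ord0) !big_ord_recl !big_ord0 /cofactor.
by rewrite !det_mx11 !mxE !AE /=; ring.
Qed.

Lemma trmx_hat x : (hat x)^T = - hat x.
Proof.
have [f xE] := cV3_entries x.
apply/matrixP => i j; rewrite !mxE !xE.
by case: i => [[|[|[|//]]] p]; case: j => [[|[|[|//]]] q] /=; ring.
Qed.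

Lemma hat_self x : hat x *m x = 0.
Proof.
have [f xE] := cV3_entries x.
apply/matrixP => i j; rewrite hat_mul !mxE !xE; ring.
Qed.

Lemma hatB x y : hat (x - y) = hat x - hat y.
Proof. by apply/matrixP => i j; rewrite !mxE; ring. Qed.

Lemma triple_product x y a : dot x (crossp y a) = dot a (crossp x y).
Proof.
have [f xE] := cV3_entries x; have [g yE] := cV3_entries y.
have [h aE] := cV3_entries a.
rewrite !dotE !big_ord_recl !big_ord0 !mxE !xE !yE !aE /=; ring.
Qed.

Lemma fnorm_vee A : fnorm (vee A) <= fnorm A.
Proof.
have [f AE] := M3_entries A.
rewrite /fnorm ler_wsqrtr// !big_ord_recl !big_ord0 !mxE !AE /=.
have sq k l : 0 <= f k l ^+ 2 by exact: sqr_ge0.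
have := (sq 0 0, sq 0 1, sq 0 2, sq 1 0, sq 1 1, sq 1 2, sq 2 0, sq 2 1, sq 2 2)%N.
by case=> [[[[[[[[]]]]]]]] => *; lra.
Qed.

(** A rotation is its own cofactor matrix, so it commutes with cross
    products. *)
Lemma hat_rotation Q x : SO3 Q -> hat x *m Q = Q *m hat (Q^T *m x).
Proof.
move=> [QTQ detQ]; have QQT : Q *m Q^T = 1%:M by exact: mulmx1C.
have conj y : Q^T *m hat (Q *m y) *m Q = \det Q *: hat y.
  have [f QE] := M3_entries Q; have [g yE] := cV3_entries y.
  rewrite (det_mx33 QE); apply/matrixP => i j.
  rewrite !mxE !big_ord_recl !big_ord0 !mxE !big_ord_recl !big_ord0 !mxE.
  rewrite !big_ord_recl !big_ord0 !QE !yE.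
  by case: i => [[|[|[|//]]] p]; case: j => [[|[|[|//]]] q] /=; ring.
rewrite -[in LHS](mul1mx x) -QQT -mulmxA -[LHS]mul1mx -QQT -mulmxA.
by congr (_ *m _); rewrite mulmxA conj detQ scale1r.
Qed.

Lemma vee_rate M x : vee (M^T *m hat x + hat x *m M) = (\tr M)%:M *m x - M *m x.
Proof.
have [f ME] := M3_entries M; have [g xE] := cV3_entries x.
apply/matrixP => i j; rewrite (ord1 j) mul_scalar_mx !mxE /mxtrace.
rewrite !big_ord_recl !big_ord0 !mxE !ME !xE.
by case: i => [[|[|[|//]]] p] /=; ring.
Qed.

Lemma SO3_mul A B : SO3 A -> SO3 B -> SO3 (A^T *m B).
Proof.
move=> [AA dA] [BB dB]; split; last by rewrite det_mulmx det_tr dA dB mulr1.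
by rewrite trmx_mul trmxK mulmxA -(mulmxA _ A) (mulmx1C AA) mulmx1.
Qed.

Lemma SO3_fnorm_mulr A Q : SO3 Q -> fnorm (A *m Q) = fnorm A.
Proof.
move=> [QQ _]; apply/eqP; rewrite -(@eqrXn2 _ 2) ?fnorm_ge0// !sqr_fnorm.
by rewrite dot_mulr -mulmxA (mulmx1C QQ) mulmx1.
Qed.

Lemma SO3_entry_le1 Q i j : SO3 Q -> `|Q i j| <= 1.
Proof.
move=> [/matrixP/(_ j j) QQ _]; move: QQ; rewrite !mxE eqxx => QQ.
rewrite -(@ler_pXn2r _ 2)// ?nnegrE// expr1n -normrX ger0_norm ?sqr_ge0//.
rewrite -[leRHS]QQ (bigD1 i)//= mxE -expr2 lerDl.
by apply: sumr_ge0 => k _; rewrite mxE -expr2 sqr_ge0.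
Qed.

End RotationAlgebra.

(** * Attitude error bounds and the decay estimate *)

Section AttitudeError.
Variables (K : realType).
Implicit Types (G Q R Rd : 'M[K]_3).

(** The matrix [E] of the kinematics [e_R' = E e_Omega], as a function of the
    relative attitude [Q = R_d^T R]; see [is_derive_err_R]. *)
Definition rate_mx G Q : 'M[K]_3 :=
  2^-1 *: ((\tr (Q^T *m G))%:M - Q^T *m G).

(** Multiplication by a rotation preserves the Frobenius norm, so the attitude
    error is bounded whatever the trajectory does. *)
Lemma fnorm_err_R G Rd R : G^T = G -> SO3 Rd -> SO3 R ->
  fnorm (err_R G Rd R) <= fnorm G.
Proof.
move=> symG SRd SR; rewrite /err_R fnormZ ger0_norm ?invr_ge0//.
rewrite ler_pdivrMl//; apply: (le_trans (fnorm_vee _)).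
apply: (le_trans (fnormD _ _)); rewrite fnormN.
have -> : R^T *m Rd *m G = (G *m Rd^T *m R)^T by rewrite !trmx_mul trmxK symG mulmxA.
rewrite fnormT -mulmxA (SO3_fnorm_mulr _ (SO3_mul SRd SR)); lra.
Qed.

(** With [M = Q^T G], the identity matrix having trace 3 gives
    [|tr M I - M|^2 = (tr M)^2 + |M|^2].  Here [|M| = |G| <= tr G], and
    [|tr M| <= tr G] since the entries of a rotation are at most 1 in absolute
    value. *)
Lemma fnorm_rate_mx g1 g2 g3 Q : 0 < g1 -> 0 < g2 -> 0 < g3 -> SO3 Q ->
  fnorm (rate_mx (diagG g1 g2 g3) Q) <= \tr (diagG g1 g2 g3) / Num.sqrt 2.
Proof.
move=> g1_gt0 g2_gt0 g3_gt0 SQ; set G := diagG _ _ _.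
have symG : G^T = G by exact: tr_diag_mx.
have trG : \tr G = g1 + g2 + g3.
  by rewrite mxtrace_diag !big_ord_recl big_ord0 !mxE /= addr0 addrA.
have nG : dot G G = g1 ^+ 2 + g2 ^+ 2 + g3 ^+ 2.
  by rewrite dotE !big_ord_recl !big_ord0 !mxE /=; ring.
have nM : dot (Q^T *m G) (Q^T *m G) = dot G G.
  by rewrite -!sqr_fnorm -fnormT trmx_mul trmxK symG SO3_fnorm_mulr.
have trM : `|\tr (Q^T *m G)| <= \tr G.
  rewrite /mxtrace; apply: (le_trans (ler_norm_sum _ _ _)); apply: ler_sum => i _.
  rewrite mul_mx_diag !mxE eqxx mulr1n normrM.
  have gi_ge0 : 0 <= [:: g1; g2; g3]`_i by case: i => [[|[|[|//]]] p] /=; exact: ltW.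
  by rewrite (ger0_norm gi_ge0) ler_piMl// SO3_entry_le1.
have tr2M : \tr (Q^T *m G) ^+ 2 <= \tr G ^+ 2.
  by rewrite -[leLHS]ger0_norm ?sqr_ge0// normrX ler_pXn2r// nnegrE ?trG; lra.
apply: ler_fnorm; first by rewrite divr_ge0// ?sqrtr_ge0// trG; lra.
rewrite expr_div_n sqr_sqrtr// /rate_mx dotZl dotZr.
have sqr_comp (M : 'M[K]_3) :
    dot ((\tr M)%:M - M) ((\tr M)%:M - M) = \tr M ^+ 2 + dot M M.
  have [f ME] := M3_entries M.
  by rewrite !dotE /mxtrace !big_ord_recl !big_ord0 !mxE !ME /=; ring.
rewrite sqr_comp nM nG; move: tr2M; rewrite trG.
by have := (mulr_gt0 g1_gt0 g2_gt0, mulr_gt0 g2_gt0 g3_gt0, mulr_gt0 g3_gt0 g1_gt0);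
  case=> [[]]; lra.
Qed.

End AttitudeError.

Section LyapunovDecay.
Variable K : realType.
Implicit Types (e Om al : 'cV[K]_3) (N J Jbar E : 'M[K]_3).

(** The worst disturbance contributes [delta n] with [n = |e|], and
    [delta n - (delta n)^2 / (delta n + eps) = eps (delta n) / (delta n + eps)],
    which is less than [eps]. *)
Lemma robust_term_le delta eps e (D : 'cV[K]_3) :
  0 < delta -> 0 < eps -> fnorm D <= delta ->
  dot e (robust_term delta eps e + D) <= eps.
Proof.
move=> delta_gt0 eps_gt0 leD; set n := fnorm e.
have n_ge0 : 0 <= n := fnorm_ge0 _.
have q_gt0 : 0 < delta * n + eps by rewrite ltr_wpDl// mulr_ge0// ltW.
rewrite dotDr /robust_term dotNr dotZr -sqr_fnorm -/n.
have eD : dot e D <= n * delta by exact: le_trans (dot_le _ _) (ler_wpM2l n_ge0 leD).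
apply: (@le_trans _ _ (n * delta - delta ^+ 2 / (delta * n + eps) * n ^+ 2)).
  by rewrite addrC lerD2r.
have -> : n * delta - delta ^+ 2 / (delta * n + eps) * n ^+ 2 =
    eps * (delta * n) / (delta * n + eps) by field; rewrite gt_eqF.
by rewrite ler_pdivrMr// ler_wpM2l ?(ltW eps_gt0)// lerDl ltW.
Qed.

(** The reason for the form of the update law.  For symmetric [N], the outer
    products of [e] and [al] both pair with [N] to [e . N al], and those of [Om]
    pair to the triple product [N Om . (e x Om) = e . (Om x N Om)].  Only the
    leakage is left. *)
Lemma adaptation_cancels kJ sigma e Om al N Jbar : kJ != 0 -> N^T = N ->
  dot e (crossp Om (N *m Om) + N *m al) +
    kJ^-1 * dot N (update_law kJ sigma e al Om Jbar) = - sigma * dot N Jbar.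
Proof.
move=> kJ0 symN; rewrite /update_law !(dotZr, dotDr, dotNr).
have e_al : dot N (e *m al^T) = dot e (N *m al).
  by rewrite dot_mulr trmxK dotC.
have al_e : dot N (al *m e^T) = dot e (N *m al).
  by rewrite dot_mulr trmxK dotC dot_mull symN dotC.
have Om_hat : dot N (Om *m Om^T *m hat e) = - dot (N *m Om) (hat e *m Om).
  rewrite dot_mulr trmx_hat mulmxN dotNl dot_mulr trmxK.
  by rewrite -mulmxA dotC dot_mull symN.
have hat_Om : dot N (hat e *m Om *m Om^T) = dot (N *m Om) (hat e *m Om).
  by rewrite dot_mulr trmxK.
rewrite e_al al_e Om_hat hat_Om triple_product -hat_mul.
by field.
Qed.

Lemma psd_bound J lM : psd J -> (forall x : 'cV[K]_3, dot x (J *m x) <= lM * dot x x) ->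
  0 <= lM -> forall x y : 'cV[K]_3, dot x (J *m y) <= lM * (fnorm x * fnorm y).
Proof.
move=> psdJ leJ lM0 x y; apply: (le_trans (ler_norm _)).
rewrite -(@ler_pXn2r _ 2)// ?nnegrE ?mulr_ge0 ?fnorm_ge0//.
rewrite -normrX ger0_norm ?sqr_ge0//; apply: (le_trans (psd_cauchy_schwarz x y psdJ)).
rewrite !exprMn !sqr_fnorm expr2 mulrACA.
by apply: ler_pM => //; exact: psdJ.2.
Qed.

(** The derivative of the Lyapunov function is estimated by five contributions:
    the exact cancellation of the adaptive terms, the robust term, the linear
    feedback, the coupling term [c e . J E e_Omega] due to the rotation of
    [e_R], and the leakage.  Writing [e_Omega = e - c e_R] and using the bound
    [B] on [e_R] leaves a quadratic damping [gam] and a linear term [N]. *)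
Lemma lyapunov_decay J Jbar E eR eOm Om dOm al D
    (lM rho B kR kOm kJ c delta sigma eps : K)
    (e := eOm + c *: eR) (gam := kOm - c * lM * rho)
    (N := `|c * kOm - kR| * B + c ^+ 2 * lM * rho * B) :
  psd J -> (forall x : 'cV[K]_3, dot x (J *m x) <= lM * dot x x) -> Jbar^T = Jbar ->
  fnorm E <= rho -> fnorm eR <= B -> fnorm D <= delta ->
  0 <= lM -> 0 < kJ -> 0 < c -> 0 < delta -> 0 < sigma -> 0 < eps -> 0 < gam ->
  J *m dOm + crossp Om (J *m Om) =
    - (kR *: eR) - kOm *: eOm + crossp Om (Jbar *m Om) + Jbar *m al
    + robust_term delta eps e + D ->
  dot e (J *m (dOm - al + c *: (E *m eOm)))
    + kJ^-1 * dot (Jbar - J) (update_law kJ sigma e al Om Jbar)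
  <= - (gam / 2 * dot e e + sigma / 2 * dot (Jbar - J) (Jbar - J))
     + (N ^+ 2 / (2 * gam) + eps + sigma / 2 * dot J J).
Proof.
move=> psdJ leJ symJbar leE leR leD lM0 kJ0 c0 delta0 sigma0 eps0 gam0 dyn.
have rho0 : 0 <= rho := le_trans (fnorm_ge0 _) leE.
have B0 : 0 <= B := le_trans (fnorm_ge0 _) leR.
set n := fnorm e; have n0 : 0 <= n := fnorm_ge0 _.
set P := Jbar - J.
have symP : P^T = P by rewrite linearB/= symJbar psdJ.1.
have eOmE : eOm = e - c *: eR by rewrite /e addrK.
have {dyn}-> : J *m (dOm - al + c *: (E *m eOm)) =
    (- (kR *: eR) - kOm *: eOm) + (crossp Om (P *m Om) + P *m al)
    + (robust_term delta eps e + D) + c *: (J *m (E *m eOm)).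
  rewrite mulmxDr mulmxBr -scalemxAr; congr (_ + _).
  rewrite -[J *m dOm](addrK (crossp Om (J *m Om))) dyn -!hat_mul !mulmxBl mulmxBr.
  by apply/matrixP => i j; rewrite !mxE; ring.
have cancel := adaptation_cancels sigma e Om al Jbar (lt0r_neq0 kJ0) symP.
have robust := robust_term_le e delta0 eps0 leD.
have feedback : dot e (- (kR *: eR) - kOm *: eOm) <=
    - (kOm * dot e e) + `|c * kOm - kR| * B * n.
  have -> : dot e (- (kR *: eR) - kOm *: eOm) =
      - (kOm * dot e e) + (c * kOm - kR) * dot e eR.
    by rewrite eOmE !(dotDr, dotNr, dotZr); ring.
  rewrite lerD2l; apply: (le_trans (ler_norm _)); rewrite normrM -mulrA.
  apply: ler_wpM2l => //; apply: (le_trans (cauchy_schwarz _ _)).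
  by rewrite mulrC ler_wpM2r.
have inertia : c * dot e (J *m (E *m eOm)) <=
    c * lM * rho * dot e e + c ^+ 2 * lM * rho * B * n.
  have leOm : fnorm eOm <= n + c * B.
    rewrite eOmE; apply: (le_trans (fnormD _ _)); rewrite fnormN fnormZ lerD2l.
    by rewrite gtr0_norm// ler_pM2l.
  have leEOm : fnorm (E *m eOm) <= rho * (n + c * B).
    by apply: (le_trans (fnormM _ _)); apply: ler_pM => //; exact: fnorm_ge0.
  have -> : c * lM * rho * dot e e + c ^+ 2 * lM * rho * B * n =
      c * (lM * (n * (rho * (n + c * B)))) by rewrite -sqr_fnorm -/n; ring.
  rewrite ler_pM2l//; apply: (le_trans (psd_bound psdJ leJ lM0 _ _)).
  by do 2!apply: ler_wpM2l => //.
have leak : - sigma * dot P Jbar <=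
    - (sigma / 2 * dot P P) + sigma / 2 * dot J J.
  have -> : dot P Jbar = 2^-1 * (dot P P + dot Jbar Jbar - dot J J).
    have -> : Jbar = P + J by rewrite subrK.
    by move: (P) => X; rewrite !dotDl !dotDr (dotC J X); field.
  have := mulr_ge0 (ltW sigma0) (dot_ge0 Jbar); lra.
(* the term linear in n is absorbed by half of the damping *)
have young : N * n <= gam / 2 * dot e e + N ^+ 2 / (2 * gam).
  rewrite -sqr_fnorm -/n -subr_ge0.
  have -> : gam / 2 * n ^+ 2 + N ^+ 2 / (2 * gam) - N * n =
      (gam * n - N) ^+ 2 / (2 * gam) by field; rewrite gt_eqF.
  by rewrite divr_ge0 ?sqr_ge0// mulr_ge0// ltW.
move: young; rewrite /N /gam => young.
rewrite 3!dotDr dotZr; lra.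
Qed.

End LyapunovDecay.

(** * Calculus of matrix-valued functions *)

Section MatrixDerivatives.
Variable K : realType.
Implicit Types t : K.

Lemma is_derive_mxP m n (A : K -> 'M[K]_(m, n)) t dA :
  is_derive t 1 A dA <->
  forall i j, is_derive t 1 (fun s => A s i j) (dA i j).
Proof.
split=> [[dA1 <-] i j|dA1].
  by split; [move/derivable_mxP: dA1; exact|rewrite derive_mx// mxE].
have derA : derivable A t 1 by apply/derivable_mxP => i j; case: (dA1 i j).
by split=> //; rewrite derive_mx//; apply/matrixP => i j; rewrite mxE;
  case: (dA1 i j).
Qed.

Lemma is_derive_trmx m n (A : K -> 'M[K]_(m, n)) t dA :
  is_derive t 1 A dA -> is_derive t 1 (fun s => (A s)^T) dA^T.
Proof.
move=> /is_derive_mxP dA1; apply/is_derive_mxP => i j; rewrite mxE.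
by under eq_fun do rewrite mxE.
Qed.

Lemma is_derive_vee (A : K -> 'M[K]_3) t dA :
  is_derive t 1 A dA -> is_derive t 1 (fun s => vee (A s)) (vee dA).
Proof.
move=> /is_derive_mxP dA1; apply/is_derive_mxP => i j; rewrite mxE.
by under eq_fun do rewrite mxE.
Qed.

Lemma is_derive_mulmx m n p (A : K -> 'M[K]_(m, n)) (B : K -> 'M[K]_(n, p))
    t dA dB :
  is_derive t 1 A dA -> is_derive t 1 B dB ->
  is_derive t 1 (fun s => A s *m B s) (dA *m B t + A t *m dB).
Proof.
move=> /is_derive_mxP dA1 /is_derive_mxP dB1; apply/is_derive_mxP => i j.
have -> : (fun s => (A s *m B s) i j) =
    \sum_k ((fun s => A s i k) * (fun s => B s k j)).
  by apply/funext => s; rewrite mxE fct_sumE.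
apply: is_derive_eq (is_derive_sum (fun k => is_deriveM (dA1 i k) (dB1 k j))) _.
rewrite !mxE -big_split; apply: eq_bigr => k _.
by rewrite /GRing.scale /= addrC (mulrC (dA i k)).
Qed.

Lemma is_derive_dot m n (A B : K -> 'M[K]_(m, n)) t dA dB :
  is_derive t 1 A dA -> is_derive t 1 B dB ->
  is_derive t 1 (fun s => dot (A s) (B s)) (dot dA (B t) + dot (A t) dB).
Proof.
move=> dA1 dB1.
have /is_derive_mxP D := is_derive_mulmx (is_derive_trmx dA1) dB1.
have -> : (fun s => dot (A s) (B s)) = \sum_i (fun s => ((A s)^T *m B s) i i).
  by apply/funext => s; rewrite fct_sumE.
apply: is_derive_eq (is_derive_sum (fun i => D i i)) _.
by rewrite /dot -linearD.
Qed.

(** Continuity is expressed entry by entry, which reduces matrix products to sums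
    and products of scalar functions on the subspace [D]. *)
Definition mx_continuous m n (D : set K) (A : K -> 'M[K]_(m, n)) : Prop :=
  forall i j, {within D, continuous (fun s => A s i j)}.

Variable D : set K.

Lemma continuous_mx m n (A : K -> 'M[K]_(m, n)) :
  {within D, continuous A} -> mx_continuous D A.
Proof.
move=> cA i j x.
apply: (@continuous_comp (subspace D) _ _ A (fun M => M i j)); first exact: cA.
exact: coord_continuous.
Qed.

Lemma derivable_mx_continuous m n (A : K -> 'M[K]_(m, n)) :
  (forall t, derivable A t 1) -> mx_continuous D A.
Proof.
move=> dA i j; apply: continuous_subspaceT => x.
by apply/differentiable_continuous/derivable1_diffP; move: i j; apply/derivable_mxP.
Qed.

Lemma mx_continuous_cst m n (A : 'M[K]_(m, n)) : mx_continuous D (fun=> A).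
Proof. by move=> i j x; exact: cst_continuous. Qed.

Lemma mx_continuous_trmx m n (A : K -> 'M[K]_(m, n)) :
  mx_continuous D A -> mx_continuous D (fun s => (A s)^T).
Proof. by move=> cA i j; under eq_fun do rewrite mxE; exact: cA. Qed.

Lemma mx_continuous_vee (A : K -> 'M[K]_3) :
  mx_continuous D A -> mx_continuous D (fun s => vee (A s)).
Proof. by move=> cA i j; under eq_fun do rewrite mxE; exact: cA. Qed.

Lemma mx_continuousD m n (A B : K -> 'M[K]_(m, n)) :
  mx_continuous D A -> mx_continuous D B -> mx_continuous D (fun s => A s + B s).
Proof.
move=> cA cB i j; under eq_fun do rewrite mxE.
by move=> x; apply: continuousD; [exact: cA|exact: cB].
Qed.

Lemma mx_continuousZ m n a (A : K -> 'M[K]_(m, n)) :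
  mx_continuous D A -> mx_continuous D (fun s => a *: A s).
Proof.
move=> cA i j; under eq_fun do rewrite mxE.
by move=> x; apply: continuousM; [exact: cst_continuous|exact: cA].
Qed.

Lemma mx_continuousB m n (A B : K -> 'M[K]_(m, n)) :
  mx_continuous D A -> mx_continuous D B -> mx_continuous D (fun s => A s - B s).
Proof.
move=> cA cB; under eq_fun do rewrite -scaleN1r.
by apply: mx_continuousD => //; exact: mx_continuousZ.
Qed.

Lemma mx_continuous_mulmx m n p (A : K -> 'M[K]_(m, n)) (B : K -> 'M[K]_(n, p)) :
  mx_continuous D A -> mx_continuous D B -> mx_continuous D (fun s => A s *m B s).
Proof.
move=> cA cB i j; under eq_fun do rewrite mxE.
apply: continuous_big => [|k _ x]; first exact: add_continuous.
by apply: continuousM; [exact: cA|exact: cB].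
Qed.

Lemma continuous_dot m n (A B : K -> 'M[K]_(m, n)) :
  mx_continuous D A -> mx_continuous D B ->
  {within D, continuous (fun s => dot (A s) (B s))}.
Proof.
move=> cA cB; apply: continuous_big => [|i _]; first exact: add_continuous.
by apply: mx_continuous_mulmx => //; exact: mx_continuous_trmx.
Qed.

End MatrixDerivatives.

(** The integrating factor [exp (kap t)] turns the differential inequality into
    the monotonicity of [exp (kap t) (f t - M)]. *)
Lemma decay_bound (K : realType) (f df : K -> K) (t0 t1 kap M : K) :
  {within `[t0, t1], continuous f} ->
  (forall t, t0 < t < t1 -> is_derive t 1 f (df t)) ->
  (forall t, t0 < t < t1 -> df t <= kap * (M - f t)) ->
  f t0 <= M -> forall t, t0 <= t <= t1 -> f t <= M.
Proof.
move=> cf dfE dfle f0 t /andP[t0t tt1].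
pose E (s : K) := expR (kap * s).
pose h s := E s * (f s - M).
have dE (s : K) : is_derive s (1 : K) E (kap * E s).
  rewrite /E; have dl : is_derive s (1 : K) (fun r : K => kap * r) kap.
    by have := @is_deriveZ _ _ _ (@id K) kap s 1 1 _; rewrite /GRing.scale/= mulr1; apply.
  have := @is_derive1_comp _ expR (fun r : K => kap * r) s _ _ (is_derive_expR _) dl.
  by rewrite mulrC.
have dh (s : K) : t0 < s < t1 ->
    is_derive s (1 : K) h (E s * df s + (f s - M) * (kap * E s)).
  move=> /dfE dfs.
  have dfM : is_derive s (1 : K) (fun r => f r - M) (df s).
    by rewrite -[df s]subr0; apply: is_deriveB.
  exact: (@is_deriveM _ _ E (fun r => f r - M)).
have ch : {within `[t0, t1], continuous h}.
  move=> x; apply: continuousM.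
    apply: continuous_subspaceT => y.
    by apply/differentiable_continuous/derivable1_diffP; case: (dE y).
  by apply: continuousB; [exact: cf|exact: cst_continuous].
have : h t <= h t0.
  apply: (@ler0_derive1_le_cc _ h t0 t1) => //.
  - by move=> s; rewrite in_itv/= => /dh[].
  - move=> s; rewrite in_itv/= => st; rewrite derive1E; case: (dh s st) => _ ->.
    have -> : E s * df s + (f s - M) * (kap * E s) =
      E s * (df s - kap * (M - f s)) by ring.
    by rewrite pmulr_rle0 ?expR_gt0// subr_le0; exact: dfle.
  - by rewrite in_itv/= t0t tt1.
  - by rewrite in_itv/= lexx (le_trans t0t tt1).
have h0 : h t0 <= 0 by rewrite pmulr_rle0 ?expR_gt0// subr_le0.
by move=> /le_trans/(_ h0); rewrite pmulr_rle0 ?expR_gt0// subr_le0.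
Qed.

(** * Kinematics of the tracking errors *)

Section ErrorKinematics.
Variable K : realType.

(** The relative attitude [Q = R_d^T R] satisfies [Q' = Q hat w] with
    [w = e_Omega], since a rotation commutes with cross products.  Hence
    [G Q - (G Q)^T] has derivative [M^T hat w + hat w M] with [M = Q^T G],
    whose vee is [(tr M I - M) w]. *)
Lemma is_derive_err_R (G : 'M[K]_3) (Rd R : K -> 'M[K]_3) (omd om : 'cV[K]_3) t :
  G^T = G -> SO3 (Rd t) -> SO3 (R t) ->
  is_derive t 1 Rd (Rd t *m hat omd) -> is_derive t 1 R (R t *m hat om) ->
  is_derive t 1 (fun s => err_R G (Rd s) (R s))
    (rate_mx G ((Rd t)^T *m R t) *m err_Om (Rd t) omd (R t) om).
Proof.
move=> symG SRd SR dRd dR; pose Q := (Rd t)^T *m R t; pose w := om - Q^T *m omd.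
have dG : is_derive t (1 : K) (fun=> G) 0 by exact: is_derive_cst.
have dGQ := is_derive_mulmx (is_derive_mulmx dG (is_derive_trmx dRd)) dR.
have dQG := is_derive_mulmx (is_derive_mulmx (is_derive_trmx dR) dRd) dG.
have dvee := is_derive_vee (is_deriveB dGQ dQG).
rewrite /err_R; apply: is_derive_eq (is_deriveZ 2^-1 dvee) _.
rewrite /rate_mx -scalemxAl mulmxBl; congr (_ *: _).
have -> : err_Om (Rd t) omd (R t) om = w.
  by rewrite /err_Om /w /Q trmx_mul trmxK.
have MT : (Q^T *m G)^T = G *m Q by rewrite trmx_mul trmxK symG.
rewrite -/Q -vee_rate MT; congr vee.
have dQ : - (hat omd *m Q) + Q *m hat om = Q *m hat w.
  by rewrite (hat_rotation _ (SO3_mul SRd SR)) -/Q hatB mulmxBr addrC.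
have QT : Q^T = (R t)^T *m Rd t by rewrite trmx_mul trmxK.
have dQT : (R t *m hat om)^T *m Rd t + (R t)^T *m (Rd t *m hat omd) =
    - (hat w *m Q^T).
  rewrite -mulNmx -trmx_hat -trmx_mul -dQ linearD linearN/= !trmx_mul !trmx_hat.
  by rewrite trmxK !(mulNmx, mulmxN, opprK, mulmxA) addrC.
rewrite dQT mul0mx add0r mulmx0 addr0 mulNmx opprK; congr (_ + _); last by rewrite mulmxA.
rewrite -[RHS]mulmxA -dQ mulmxDr /Q trmx_mul trmx_hat.
by rewrite !(mulNmx, mulmxN, mulmxA).
Qed.

(** The term in which [R_d] is differentiated is a multiple of
    [Omega_d x Omega_d] and vanishes; the other two make up [alpha_d]. *)
Lemma is_derive_err_Om (Rd R : K -> 'M[K]_3) (Omd Om : K -> 'cV[K]_3) (t : K)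
    (dOmd dOm : 'cV[K]_3) :
  is_derive t 1 Rd (Rd t *m hat (Omd t)) -> is_derive t 1 R (R t *m hat (Om t)) ->
  is_derive t 1 Omd dOmd -> is_derive t 1 Om dOm ->
  is_derive t 1 (fun s => err_Om (Rd s) (Omd s) (R s) (Om s))
    (dOm - alpha_d (Rd t) (Omd t) dOmd (R t) (Om t)).
Proof.
move=> dRd dR dOmd1 dOm1.
have dRRO := is_derive_mulmx (is_derive_mulmx (is_derive_trmx dR) dRd) dOmd1.
apply: is_derive_eq (is_deriveB dOm1 dRRO) _; congr (_ - _).
rewrite /alpha_d trmx_mul trmx_hat mulmxDl -!mulmxA hat_self !mulmx0 addr0.
by rewrite !mulNmx !mulmxA.
Qed.

(** The desired velocity inherits its regularity from the attitude command
    through this formula, whose right-hand side is differentiable at all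
    times. *)
Lemma command_velocity (Rd : K -> 'M[K]_3) (Omd : K -> 'cV[K]_3) (t : K) :
  attitude_command Rd Omd -> 0 <= t -> Omd t = vee ((Rd t)^T *m derive1 Rd t).
Proof.
move=> [_ SRd dRd] t_ge0; rewrite (dRd _ t_ge0) mulmxA.
by have [-> _] := SRd _ t_ge0; rewrite mul1mx hatK.
Qed.

Lemma derivable_command_velocity (Rd : K -> 'M[K]_3) (Omd : K -> 'cV[K]_3) (t : K) :
  attitude_command Rd Omd ->
  derivable (fun s => vee ((Rd s)^T *m derive1 Rd s)) t 1.
Proof.
move=> [smooth _ _].
have dRd : is_derive t 1 Rd ('D_1 Rd t) := derivableP (smooth 0%N t).
have ddRd : is_derive t 1 (derive1 Rd) ('D_1 (derive1 Rd) t) := derivableP (smooth 1%N t).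
by case: (is_derive_vee (is_derive_mulmx (is_derive_trmx dRd) ddRd)).
Qed.

Lemma is_derive_Omd (Rd : K -> 'M[K]_3) (Omd : K -> 'cV[K]_3) (t : K) :
  attitude_command Rd Omd -> 0 < t -> is_derive t 1 Omd (derive1 Omd t).
Proof.
move=> cmd t_gt0; rewrite derive1E; apply: derivableP.
apply: near_eq_derivable (derivable_command_velocity cmd).
near=> s; rewrite (command_velocity cmd)//; apply: ltW; near: s.
exact: lt_nbhsr.
Unshelve. all: by end_near. Qed.

Lemma mx_continuous_Omd (Rd : K -> 'M[K]_3) (Omd : K -> 'cV[K]_3) t0 t1 :
  attitude_command Rd Omd -> 0 <= t0 -> mx_continuous `[t0, t1] Omd.
Proof.
move=> cmd t0_ge0 i j.
have cOmd := derivable_mx_continuous (D := `[t0, t1])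
  (fun t => derivable_command_velocity (t := t) cmd).
apply: (subspace_eq_continuous _ (cOmd i j)) => s.
rewrite inE/= in_itv/= => /andP[t0s _].
have OmdE := command_velocity cmd (le_trans t0_ge0 t0s).
exact: (congr1 (fun v : 'cV[K]_3 => v i j) (esym OmdE)).
Qed.

End ErrorKinematics.

(** * Boundedness along trajectories *)

Section Boundedness.
Variable K : realType.

Definition lyapunov (J : 'M[K]_3) (kJ : K) (e : 'cV[K]_3) (P : 'M[K]_3) : K :=
  2^-1 * dot e (J *m e) + (2 * kJ)^-1 * dot P P.

Lemma is_derive_lyapunov (J : 'M[K]_3) kJ (e : K -> 'cV[K]_3) (P : K -> 'M[K]_3)
    (t : K) de dP :
  J^T = J -> is_derive t 1 e de -> is_derive t 1 P dP ->
  is_derive t 1 (fun s => lyapunov J kJ (e s) (P s))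
    (dot (e t) (J *m de) + kJ^-1 * dot (P t) dP).
Proof.
move=> symJ de1 dP1.
have dJ : is_derive t (1 : K) (fun=> J) 0 by exact: is_derive_cst.
have dee := is_deriveZ 2^-1 (is_derive_dot de1 (is_derive_mulmx dJ de1)).
have dPP := is_deriveZ (2 * kJ)^-1 (is_derive_dot dP1 dP1).
apply: is_derive_eq (is_deriveD dee dPP) _.
have swap : dot de (J *m e t) = dot (e t) (J *m de).
  by rewrite [RHS]dot_mull symJ dotC.
rewrite mul0mx add0r swap (dotC dP) /GRing.scale/= invfM.
by move: kJ^-1 => k; field.
Qed.

Lemma continuous_lyapunov (D : set K) J kJ (e : K -> 'cV[K]_3) (P : K -> 'M[K]_3) :
  mx_continuous D e -> mx_continuous D P ->
  {within D, continuous (fun s => lyapunov J kJ (e s) (P s))}.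
Proof.
move=> ce cP.
have cJ : mx_continuous D (fun=> J) by exact: mx_continuous_cst.
have scale a (f : K -> K) :
    {within D, continuous f} -> {within D, continuous (fun s => a * f s)}.
  by move=> cf x; apply: continuousM; [exact: cst_continuous|exact: cf].
have cee := scale 2^-1 _ (continuous_dot ce (mx_continuous_mulmx cJ ce)).
have cPP := scale (2 * kJ)^-1 _ (continuous_dot cP cP).
move=> x; exact: (continuousD (cee x) (cPP x)).
Qed.

Lemma mx_continuous_err_R D (G : 'M[K]_3) (Rd R : K -> 'M[K]_3) :
  mx_continuous D Rd -> mx_continuous D R ->
  mx_continuous D (fun s => err_R G (Rd s) (R s)).
Proof.
move=> cRd cR; apply: mx_continuousZ; apply: mx_continuous_vee.
have cG : mx_continuous D (fun=> G) by exact: mx_continuous_cst.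
by apply: mx_continuousB; do 2?[apply: mx_continuous_mulmx => //];
  exact: mx_continuous_trmx.
Qed.

Lemma mx_continuous_err_Om D (Rd R : K -> 'M[K]_3) (Omd Om : K -> 'cV[K]_3) :
  mx_continuous D Rd -> mx_continuous D R -> mx_continuous D Omd ->
  mx_continuous D Om ->
  mx_continuous D (fun s => err_Om (Rd s) (Omd s) (R s) (Om s)).
Proof.
move=> cRd cR cOmd cOm; apply: mx_continuousB => //.
by do 2!apply: mx_continuous_mulmx => //; exact: mx_continuous_trmx.
Qed.

(** The rate [kap] is chosen below both [gam / lM] and [sigma kJ], so that the
    damping of [e] and the leakage of [Jbar - J] dominate [kap V].  A level [M]
    with [kap M] above the residual constant cannot then be crossed upwards. *)
Lemma lyapunov_bounded (G J : 'M[K]_3)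
    (lM rho delta kR kOm kJ c sigma eps kap M : K)
    (Rd : K -> 'M[K]_3) (Omd : K -> 'cV[K]_3) (t0 t1 : K)
    (R : K -> 'M[K]_3) (Om : K -> 'cV[K]_3) (Jbar : K -> 'M[K]_3)
    (Delta : K -> 'cV[K]_3)
    (gam := kOm - c * lM * rho)
    (N := `|c * kOm - kR| * fnorm G + c ^+ 2 * lM * rho * fnorm G)
    (V := fun s => lyapunov J kJ (err_A G c (Rd s) (Omd s) (R s) (Om s)) (Jbar s - J)) :
  G^T = G -> (forall Q, SO3 Q -> fnorm (rate_mx G Q) <= rho) ->
  psd J -> (forall x : 'cV[K]_3, dot x (J *m x) <= lM * dot x x) -> 0 <= lM ->
  0 < delta -> 0 < kJ -> 0 < c -> 0 < sigma -> 0 < eps -> 0 < gam ->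
  0 < kap -> kap * lM <= gam -> kap <= sigma * kJ ->
  attitude_command Rd Omd -> 0 <= t0 ->
  closed_loop G J delta kR kOm kJ c sigma eps Rd Omd t0 t1 R Om Jbar Delta ->
  N ^+ 2 / (2 * gam) + eps + sigma / 2 * dot J J <= kap * M ->
  V t0 <= M -> forall t, t0 <= t <= t1 -> V t <= M.
Proof.
move=> symG leE psdJ leJ lM0 delta0 kJ0 c0 sigma0 eps0 gam0 kap0 kap_gam kap_sig.
move=> cmd t0_ge0 cl leM V0.
have [smooth SRd dRd] := cmd.
pose dV s := dot (err_A G c (Rd s) (Omd s) (R s) (Om s))
    (J *m (derive1 Om s - alpha_d (Rd s) (Omd s) (derive1 Omd s) (R s) (Om s)
      + c *: (rate_mx G ((Rd s)^T *m R s) *m err_Om (Rd s) (Omd s) (R s) (Om s))))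
  + kJ^-1 * dot (Jbar s - J) (derive1 Jbar s).
apply: (@decay_bound _ V dV t0 t1 kap M) => //.
- have cRd := derivable_mx_continuous (D := `[t0, t1]) (smooth 0%N).
  have cR := continuous_mx (cl_cont_R cl).
  have cOmd := mx_continuous_Omd (t1 := t1) cmd t0_ge0.
  have cOm := continuous_mx (cl_cont_Om cl).
  apply: continuous_lyapunov.
    apply: mx_continuousD; first exact: mx_continuous_err_Om.
    by apply: mx_continuousZ; exact: mx_continuous_err_R.
  apply: mx_continuousB; first exact: (continuous_mx (cl_cont_Jbar cl)).
  exact: mx_continuous_cst.
- move=> s s_in; have /andP[t0s st1] := s_in.
  have s_cc : t0 <= s <= t1 by rewrite !ltW.
  have s_gt0 : 0 < s := le_lt_trans t0_ge0 t0s.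
  have [derR derOm derJ] := cl_derivable cl s_in.
  have dRd1 : is_derive s 1 Rd (Rd s *m hat (Omd s)).
    rewrite -(dRd s (ltW s_gt0)) derive1E; apply: derivableP.
    exact: (smooth 0%N s).
  have dR1 : is_derive s 1 R (R s *m hat (Om s)).
    by rewrite -(cl_kinematics cl s_in) derive1E; apply: derivableP.
  have dOm1 : is_derive s 1 Om (derive1 Om s) by rewrite derive1E; apply: derivableP.
  have dJ1 : is_derive s 1 Jbar (derive1 Jbar s) by rewrite derive1E; apply: derivableP.
  apply: is_derive_lyapunov; first exact: psdJ.1.
    apply: is_deriveD (is_derive_err_Om dRd1 dR1 (is_derive_Omd cmd s_gt0) dOm1) _.
    apply: is_deriveZ.
    exact: (is_derive_err_R symG (SRd _ (ltW s_gt0)) (cl_SO3 cl s_cc) dRd1 dR1).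
  by rewrite -[derive1 Jbar s]subr0; apply: is_deriveB.
- move=> s s_in; have /andP[t0s st1] := s_in.
  have s_cc : t0 <= s <= t1 by rewrite !ltW.
  have s_ge0 : 0 <= s by rewrite (le_trans t0_ge0)// ltW.
  have SRds := SRd _ s_ge0; have SRs := cl_SO3 cl s_cc.
  rewrite /dV (cl_update cl s_in).
  apply: (le_trans (lyapunov_decay psdJ leJ (cl_sym cl s_cc)
    (leE _ (SO3_mul SRds SRs)) (fnorm_err_R symG SRds SRs) (cl_Delta cl s_cc)
    lM0 kJ0 c0 delta0 sigma0 eps0 gam0 (cl_dynamics cl s_in))).
  rewrite -/gam -/N -/(err_A G c (Rd s) (Omd s) (R s) (Om s)).
  rewrite [leRHS]mulrBr [leLHS]addrC; apply: lerB => //; rewrite /V /lyapunov.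
  set e := err_A _ _ _ _ _ _; set P := Jbar s - J; rewrite mulrDr; apply: lerD.
    rewrite mulrCA mulrAC [leRHS]mulrC ler_wpM2l ?invr_ge0//.
    apply: (le_trans (ler_wpM2l (ltW kap0) (leJ e))).
    by rewrite mulrA ler_wpM2r// dot_ge0.
  rewrite invfM mulrA ler_wpM2r ?dot_ge0// mulrA ler_pdivrMr//.
  by rewrite mulrAC ler_wpM2r ?invr_ge0.
Qed.

Lemma fnorm_le_errors_norm (z : errors K) :
  fnorm z.1.2 <= errors_norm z /\ fnorm z.2 <= errors_norm z.
Proof.
rewrite /errors_norm.
split; rewrite -[leLHS]ger0_norm ?fnorm_ge0// -sqrtr_sqr ler_wsqrtr//.
  by rewrite -addrA addrCA lerDl addr_ge0 ?sqr_ge0.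
by rewrite lerDr addr_ge0 ?sqr_ge0.
Qed.

Lemma errors_norm_le (z : errors K) x y w :
  0 <= x -> 0 <= y -> 0 <= w ->
  fnorm z.1.1 <= x -> fnorm z.1.2 <= y -> fnorm z.2 <= w ->
  errors_norm z <= x + y + w.
Proof.
move=> x0 y0 w0 zx zy zw.
rewrite -[leRHS]ger0_norm ?addr_ge0// -sqrtr_sqr ler_wsqrtr//.
have sq (a b : K) : 0 <= a -> a <= b -> a ^+ 2 <= b ^+ 2.
  by move=> a0 ab; rewrite ler_pXn2r// nnegrE// (le_trans a0).
have := sq _ _ (fnorm_ge0 _) zx; have := sq _ _ (fnorm_ge0 _) zy.
have := sq _ _ (fnorm_ge0 _) zw.
have := mulr_ge0 x0 y0; have := mulr_ge0 x0 w0; have := mulr_ge0 y0 w0.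
by move=> *; lra.
Qed.

End Boundedness.

Theorem proposition8 (K : realType) (g1 g2 g3 : K) (J : 'M[K]_3)
    (lambda_m lambda_M delta k_R k_Om k_J c : K)
    (Rd : K -> 'M[K]_3) (Omd : K -> 'cV[K]_3)
    (G := diagG g1 g2 g3) (b := b1 g1 g2 g3) :
  0 < g1 -> 0 < g2 -> 0 < g3 -> g1 != g2 -> g2 != g3 -> g3 != g1 ->
  inertia_matrix J ->
  min_eigenvalue J lambda_m -> max_eigenvalue J lambda_M ->
  0 < delta -> 0 < k_R -> 0 < k_Om -> 0 < k_J -> 0 < c ->
  c < Num.min (Num.sqrt (2 * b * k_R * lambda_m / lambda_M ^+ 2))
        (Num.min (Num.sqrt 2 * k_Om / (lambda_M * \tr G))
           (4 * k_R * k_Om /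
              (k_Om ^+ 2 + (Num.sqrt 2)^-1 * k_R * lambda_M * \tr G))) ->
  attitude_command Rd Omd ->
  exists sigma0 eps0 : K, [/\ 0 < sigma0, 0 < eps0 &
    forall sigma eps : K, 0 < sigma < sigma0 -> 0 < eps < eps0 ->
      uniformly_bounded (@errors_norm K)
        (error_trajectory G J delta k_R k_Om k_J c sigma eps Rd Omd)].
Proof.
move=> g1_gt0 g2_gt0 g3_gt0 _ _ _ [symJ J_gt0] [eigm minm] [_ maxM].
move=> delta0 kR0 kOm0 kJ0 c0 c_lt cmd.
have symG : G^T = G by exact: tr_diag_mx.
have trG_gt0 : 0 < \tr G.
  by rewrite mxtrace_diag !big_ord_recl big_ord0 !mxE/= addr0 !addr_gt0.
have dotJ (x : 'cV[K]_3) : (x^T *m J *m x) 0 0 = dot x (J *m x).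
  by rewrite /dot mulmxA -trace_mx11.
have psdJ : psd J.
  split=> // x; have [->|x0] := eqVneq x 0; first by rewrite mulmx0 /dot mulmx0 linear0.
  by rewrite -dotJ ltW// J_gt0.
have leJ (x : 'cV[K]_3) : dot x (J *m x) <= lambda_M * dot x x.
  have [mu /maxM muM /(_ x) /le_trans->//] := rayleigh_max symJ.
  by rewrite ler_wpM2r ?dot_ge0.
have geJ (x : 'cV[K]_3) : lambda_m * dot x x <= dot x (J *m x).
  have [mu /minm mum /(_ x)] := rayleigh_min symJ.
  by apply: le_trans; rewrite ler_wpM2r ?dot_ge0.
have lm_gt0 : 0 < lambda_m.
  have /eigenvalueP[v vJ v0] := eigm.
  have vT0 : v^T != 0 by rewrite trmx_eq0.
  have := J_gt0 _ vT0; rewrite trmxK vJ -scalemxAl mxE -trace_mx11.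
  have -> : \tr (v *m v^T) = dot v^T v^T by rewrite /dot trmxK.
  by rewrite pmulr_lgt0// -sqr_fnorm exprn_gt0// fnorm_gt0.
have lM_gt0 : 0 < lambda_M := lt_le_trans lm_gt0 (maxM _ eigm).
have sqrt2_gt0 : 0 < Num.sqrt 2 :> K by rewrite sqrtr_gt0.
pose rho := \tr G / Num.sqrt 2; pose gam := k_Om - c * lambda_M * rho.
have gam0 : 0 < gam.
  move: c_lt; rewrite !lt_min => /and3P[_ c_lt _].
  rewrite subr_gt0 /rho mulrA ltr_pdivrMr// -mulrA -ltr_pdivlMr ?mulr_gt0//.
  by rewrite (mulrC k_Om).
(* the decay estimate holds for all positive sigma and eps *)
exists 1, 1; split=> // sigma eps /andP[sigma0 _] /andP[eps0 _] a a0.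
pose kap := Num.min (gam / lambda_M) (sigma * k_J).
have kap0 : 0 < kap by rewrite lt_min divr_gt0 ?mulr_gt0.
pose B := fnorm G; have B0 : 0 <= B := fnorm_ge0 _.
pose N := `|c * k_Om - k_R| * B + c ^+ 2 * lambda_M * rho * B.
pose C := N ^+ 2 / (2 * gam) + eps + sigma / 2 * dot J J.
(* M0 bounds the Lyapunov function at t0: there |e| <= |e_Omega| + c |e_R| *)
pose M0 := 2^-1 * (lambda_M * (a + c * B) ^+ 2) + (2 * k_J)^-1 * a ^+ 2.
pose M := Num.max M0 (C / kap).
have M0_gt0 : 0 < M0.
  rewrite ltr_wpDl ?mulr_gt0 ?invr_gt0 ?exprn_gt0 ?mulr_gt0//.
  by rewrite mulr_ge0 ?invr_ge0// mulr_ge0 ?sqr_ge0// ltW.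
have M_gt0 : 0 < M by rewrite lt_max M0_gt0.
(* y and w bound |e| and |J - Jbar| on the sublevel set of level M *)
pose y := Num.sqrt (2 * M / lambda_m); pose w := Num.sqrt (2 * k_J * M).
have y0 : 0 <= y := sqrtr_ge0 _.
have w_gt0 : 0 < w by rewrite sqrtr_gt0 !mulr_gt0.
exists (B + (y + c * B) + w).
  by rewrite ltr_wpDl// !addr_ge0// mulr_ge0// ltW.
move=> t0 t1 z t0_ge0 [R [Om [Jbar [Delta [cl zE]]]]] z0 t t_in.
have t0_in : t0 <= t0 <= t1 by case/andP: t_in => t0t tt1; rewrite lexx (le_trans t0t).
have leR s : t0 <= s <= t1 -> fnorm (err_R G (Rd s) (R s)) <= B.
  move=> s_in; apply: fnorm_err_R => //; last exact: (cl_SO3 cl s_in).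
  by case: cmd => _ SRd _; apply: SRd; case/andP: s_in => /(le_trans t0_ge0).
have leV : lyapunov J k_J (err_A G c (Rd t) (Omd t) (R t) (Om t)) (Jbar t - J) <= M.
  apply: (@lyapunov_bounded _ G J lambda_M rho delta k_R k_Om k_J c sigma eps
    kap M Rd Omd t0 t1 R Om Jbar Delta) => //; try exact: ltW.
  - by move=> Q SQ; exact: fnorm_rate_mx.
  - by rewrite -ler_pdivlMr// ge_min lexx.
  - by rewrite ge_min lexx orbT.
  - by rewrite [leRHS]mulrC -ler_pdivrMr// /M le_max lexx orbT.
  - rewrite le_max; apply/orP; left.
    have [zOm zJ] := fnorm_le_errors_norm (z t0).
    have {}zOm := le_trans zOm z0; have {}zJ := le_trans zJ z0.
    move: zOm zJ; rewrite zE /= => zOm zJ.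
    have sq (p q : K) : 0 <= p -> p <= q -> p ^+ 2 <= q ^+ 2.
      by move=> p0 pq; rewrite ler_pXn2r// nnegrE// (le_trans p0).
    apply: lerD; apply: ler_wpM2l; rewrite ?invr_ge0 ?mulr_ge0 ?(ltW kJ0)//.
      apply: (le_trans (leJ _)); rewrite ler_wpM2l ?(ltW lM_gt0)// -sqr_fnorm.
      apply: sq; first exact: fnorm_ge0.
      apply: (le_trans (fnormD _ _)); apply: lerD => //.
      by rewrite fnormZ gtr0_norm// ler_wpM2l ?(ltW c0)// leR.
    by rewrite -sqr_fnorm -fnormN opprB; apply: sq => //; exact: fnorm_ge0.
have JP0 := psdJ.2 (err_A G c (Rd t) (Omd t) (R t) (Om t)).
have PP0 := dot_ge0 (Jbar t - J).
have le_e : fnorm (err_A G c (Rd t) (Omd t) (R t) (Om t)) <= y.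
  apply: ler_fnorm => //; rewrite sqr_sqrtr; last by rewrite !mulr_ge0 ?invr_ge0 ?ltW.
  rewrite ler_pdivlMr// mulrC; apply: (le_trans (geJ _)).
  have : 0 <= (2 * k_J)^-1 * dot (Jbar t - J) (Jbar t - J).
    by rewrite mulr_ge0// invr_ge0 mulr_ge0// ltW.
  by move: leV; rewrite /lyapunov; lra.
have le_P : fnorm (J - Jbar t) <= w.
  rewrite -fnormN opprB; apply: ler_fnorm; first exact: ltW.
  rewrite sqr_sqrtr; last by rewrite !mulr_ge0// ltW.
  rewrite -ler_pdivrMl ?mulr_gt0//.
  by move: leV; rewrite /lyapunov; lra.
rewrite zE; apply: errors_norm_le => //=;
  rewrite ?addr_ge0 ?mulr_ge0 ?(ltW c0) ?(ltW w_gt0)//.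
  exact: leR.
rewrite -[err_Om _ _ _ _](addrK (c *: err_R G (Rd t) (R t))).
apply: (le_trans (fnormD _ _)); rewrite fnormN; apply: lerD => //.
by rewrite fnormZ gtr0_norm// ler_wpM2l ?(ltW c0)// leR.
Qed.
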